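(* Let $\alpha^{(\ell)}=\{\alpha^{(\ell)}_k\}_{k\in\mathbb{Z}}\subset\mathbb{D}$, $\ell=1,2$, and let $k_0\in\mathbb{Z}$, $N\in\mathbb{N}$. For $\ell=1,2$ let $g^{(\ell)}(z,k)$ and $h^{(\ell)}(z,k)$ ($z\in\mathbb{D}$, $k\in\mathbb{Z}$) be the diagonal and neighboring off-diagonal entries of the Green's function of the full-lattice CMV operator associated with $\alpha^{(\ell)}$, as defined in the context. Then the following local uniqueness results hold: (i) If either $h^{(1)}(0,k_0)$ or $h^{(2)}(0,k_0)$ is nonzero and $$\bigl|g^{(1)}(z,k_0)-g^{(2)}(z,k_0)\bigr|+\bigl|h^{(1)}(z,k_0)-h^{(2)}(z,k_0)\bigr|=o(z^N)\quad\text{as } z\to 0,$$ then $\alpha^{(1)}_k=\alpha^{(2)}_k$ for $k_0-N\leq k\leq k_0+N+1$. (ii) If $\alpha^{(1)}_{k_0}=\alpha^{(2)}_{k_0}\neq 0$ and $$\bigl|g^{(1)}(z,k_0-1)-g^{(2)}(z,k_0-1)\bigr|+\bigl|g^{(1)}(z,k_0)-g^{(2)}(z,k_0)\bigr|=o(z^N)\quad\text{as } z\to 0,$$ then $\alpha^{(1)}_k=\alpha^{(2)}_k$ for $k_0-N-1\leq k\leq k_0+N+1$.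
   Context: $\mathbb{D}$ denotes the open unit disk in $\mathbb{C}$, and $\mathbb{N}=\{1,2,3,\dots\}$. $\ell^2(\mathbb{Z})$ is the Hilbert space of square summable complex-valued sequences with standard basis $\{\delta_k\}_{k\in\mathbb{Z}}$; for a bounded operator $A$ on $\ell^2(\mathbb{Z})$, $A(k,k')=A_{k,k'}=(\delta_k,A\delta_{k'})_{\ell^2(\mathbb{Z})}$ denotes its matrix entries (row $k$, column $k'$), the scalar product being linear in the second argument. Given $\alpha=\{\alpha_k\}_{k\in\mathbb{Z}}\subset\mathbb{D}$ (the Verblunsky coefficients), set $\rho_k=\sqrt{1-|\alpha_k|^2}$ and define the unitary $2\times 2$ matrices $$\Theta_k=\begin{pmatrix}-\alpha_k&\rho_k\\ \rho_k&\overline{\alpha_k}\end{pmatrix},\quad k\in\mathbb{Z}.$$ Let $V$ and $W$ be the unitary block diagonal operators on $\ell^2(\mathbb{Z})$ whose $2\times 2$ diagonal blocks are, for $k\in\mathbb{Z}$, $$\begin{pmatrix}V_{2k-1,2k-1}&V_{2k-1,2k}\\ V_{2k,2k-1}&V_{2k,2k}\end{pmatrix}=\Theta_{2k},\qquad \begin{pmatrix}W_{2k,2k}&W_{2k,2k+1}\\ W_{2k+1,2k}&W_{2k+1,2k+1}\end{pmatrix}=\Theta_{2k+1},$$ all other matrix entries being zero. The full-lattice CMV operator associated with $\alpha$ is the unitary operator $U=VW$ on $\ell^2(\mathbb{Z})$. For $z\in\mathbb{D}$ and $k\in\mathbb{Z}$ define $$g(z,k)=(U-zI)^{-1}(k,k),\qquad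 h(z,k)=\begin{cases}(U-zI)^{-1}(k-1,k),&k\text{ odd},\\ (U-zI)^{-1}(k,k-1),&k\text{ even}.\end{cases}$$ For $\ell=1,2$, $g^{(\ell)}$ and $h^{(\ell)}$ denote these quantities for the operator $U=U^{(\ell)}$ associated with the sequence $\alpha=\alpha^{(\ell)}$. *)

(* Defs.v *)
From HB Require Import structures.
From mathcomp Require Import all_boot all_order all_algebra.
From mathcomp Require Import complex.
From mathcomp Require Import all_classical all_reals all_analysis.
From mathcomp Require Import zify ring lra.

Set Implicit Arguments.
Unset Strict Implicit.
Unset Printing Implicit Defensive.

Import Order.TTheory GRing.Theory Num.Theory.
Import numFieldNormedType.Exports.

Local Open Scope classical_set_scope.
Local Open Scope ring_scope.

(* The library puts no topology on the type R[i] itself, only on its alias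
   R[i]^o; this copies the norm topology over. *)
HB.instance Definition _ (R : realType) := NormedModule.copy R[i] R[i]^o.

Section Ell2.
Variable R : realType.
Local Notation C := R[i].
Implicit Types u v : int -> C.

Definition square_summable : {pred int -> C} :=
  fun u => `[< summable [set: int] (fun k => (Normc.normc (u k) ^+ 2)%:E) >].

Lemma normc_ge0 (x : C) : 0 <= Normc.normc x.
Proof. by case: x => a b; exact: sqrtr_ge0. Qed.

Lemma square_summable_le u v :
    (forall k, Normc.normc (v k) <= Normc.normc (u k)) ->
  u \in square_summable -> v \in square_summable.
Proof.
move=> vu /asboolP su; apply/asboolP; apply: le_lt_trans su.
apply: le_esum => k _; rewrite /= lee_fin !ger0_norm ?sqr_ge0//.
by rewrite ler_sqr ?nnegrE ?vu ?normc_ge0.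
Qed.

Lemma square_summableD u v : u \in square_summable -> v \in square_summable ->
  u + v \in square_summable.
Proof.
move=> /asboolP su /asboolP sv; apply/asboolP.
have s := summableD su sv; apply: le_lt_trans (summableD s s).
apply: le_esum => k _.
rewrite /= lee_fin !ger0_norm ?addr_ge0 ?sqr_ge0// !fctE.
apply: (@le_trans _ _ ((Normc.normc (u k) + Normc.normc (v k)) ^+ 2)).
  by rewrite ler_sqr ?nnegrE ?addr_ge0 ?normc_ge0 ?le_normcD.
rewrite -subr_ge0; have := sqr_ge0 (Normc.normc (u k) - Normc.normc (v k)).
by congr (0 <= _); ring.
Qed.

Lemma square_summable_shift (c : int) u :
  u \in square_summable -> (fun k => u (k + c)) \in square_summable.
Proof.
move=> /asboolP su; apply/asboolP; rewrite /summable.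
rewrite -(@reindex_esum R _ _ setT setT (fun k => k + c)
  (fun k => `|(Normc.normc (u k) ^+ 2)%:E|%E))//.
split => //= [k l _ _ /addIr//|k _]; exists (k - c) => //.
by rewrite subrK.
Qed.

Lemma square_summable_submod : submod_closed square_summable.
Proof.
have s0 : 0 \in square_summable.
  apply/asboolP; rewrite /summable esum1 ?ltry// => k _.
  by rewrite Normc.normc0 expr0n/= normr0.
split=> [//|a u v su sv]; apply: square_summableD => //.
pose n := Num.bound (Normc.normc a).
apply: (@square_summable_le (u *+ n)) => [k|].
  have -> : (u *+ n) k = u k *+ n.
    by elim: (n) => [//|m IH]; rewrite !mulrS -IH.
  rewrite -mulr_natl !Normc.normcM ler_wpM2r ?normc_ge0//.
  have := @normcMn R 1 n; rewrite Normc.normc1 => ->.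
  by apply/ltW/archi_boundP/normc_ge0.
by elim: n => [//|m IH]; rewrite mulrS; exact: square_summableD.
Qed.

HB.instance Definition _ :=
  GRing.isSubmodClosed.Build _ _ square_summable square_summable_submod.

Record ell2 := Ell2 {
  ell2_fun :> int -> C;
  ell2_prop : ell2_fun \in square_summable }.

HB.instance Definition _ := [isSub for ell2_fun].
HB.instance Definition _ := [Choice of ell2 by <:].
HB.instance Definition _ := [SubChoice_isSubLmodule of ell2 by <:].

(* The scalar product, linear in the second argument.  The two-sided series
   converges absolutely on ell2, so symmetric partial sums may be used. *)
Definition ell2_inner (u v : ell2) : C :=
  lim ((\sum_(i < n.*2.+1) (u (i%:Z - n%:Z))^* * v (i%:Z - n%:Z) : C)
       @[n --> \oo]).

Fact delta_subproof (k : int) :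
  (fun j : int => (j == k)%:R : C) \in square_summable.
Proof.
apply/asboolP; rewrite /summable (esum_mkcond setT).
rewrite (_ : (fun _ => _) =
  (fun j => if j \in [set k] then (1 : R)%:E else 0)%E); last first.
  apply/funext => j; rewrite in_setT; have [->|jk] := eqVneq j k.
    by rewrite mem_set// Normc.normc1 expr1n/= normr1.
  by rewrite memNset ?Normc.normc0 ?expr0n/= ?normr0//; exact/eqP.
by rewrite -esum_mkcond esum_set1 ?ltry// lee_fin.
Qed.

Definition delta (k : int) : ell2 := Ell2 (delta_subproof k).

Definition entry (A : ell2 -> ell2) (k k' : int) : C :=
  ell2_inner (delta k) (A (delta k')).

Lemma entryE A k k' : entry A k k' = A (delta k') k.
Proof.
apply: cvg_lim => //; apply: cvg_near_cst; near=> n.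
have kn : (absz k <= n)%N by near: n; exact: nbhs_infty_ge.
have lt_i : (absz (k + n%:Z)%R < n.*2.+1)%N by lia.
rewrite (bigD1 (Ordinal lt_i))//= big1 ?addr0 => [|i ik].
  have -> : (absz (k + n%:Z))%:Z - n%:Z = k by lia.
  by rewrite eqxx conjC1 mul1r.
rewrite [_ == k]negbTE ?conjC0 ?mul0r//; apply: contraNN ik => /eqP ik.
by apply/eqP/val_inj => /=; lia.
Unshelve. all: by end_near. Qed.

(* The inverse of A - z I whenever this is a bijection of ell2 (for instance A
   unitary and |z| < 1); 'pinv_ extends it by a junk value otherwise. *)
Definition resolvent (A : ell2 -> ell2) (z : C) : ell2 -> ell2 :=
  'pinv_(fun=> 0) [set: ell2] (fun w : ell2 => A w - z *: w).

End Ell2.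

Section CMV.
Variable R : realType.
Local Notation C := R[i].

Record verblunsky := Verblunsky {
  verblunsky_fun :> int -> C;
  verblunsky_lt1 : forall k, `|verblunsky_fun k| < 1 }.

Definition Theta (a : C) : 'M[C]_2 :=
  let rho := sqrtC (1 - `|a| ^+ 2) in
  \matrix_(i, j) if i == 0 then (if j == 0 then - a else rho)
                 else (if j == 0 then rho else a^*).

Definition oddz (k : int) : bool := odd `|k|%N.

Lemma oddz_even (k : int) (n : nat) : oddz (2 * k + n%:Z) = odd n.
Proof. by rewrite /oddz; lia. Qed.

Lemma oddz_odd (k : int) (n : nat) : oddz (2 * k - 1 + n%:Z) = ~~ odd n.
Proof. by rewrite /oddz; lia. Qed.

Lemma Theta_le1 (a : C) i j : `|a| < 1 -> Normc.normc (Theta a i j) <= 1.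
Proof.
move=> a1; rewrite -lecR -[X in X <= _]/(`|Theta a i j|) rmorph1 mxE.
have a2 : 0 <= 1 - `|a| ^+ 2 by rewrite subr_ge0 expr_le1// ltW.
have r1 : `|sqrtC (1 - `|a| ^+ 2)| <= 1.
  by rewrite ger0_norm ?sqrtC_ge0// -[leRHS]sqrtC1 ler_sqrtC ?qualifE/= ?ler01//.
by do 2![case: ifP => _]; rewrite ?normrN ?norm_conjC// ltW.
Qed.

Variable alpha : verblunsky.

(* The block diagonal operator with the 2 x 2 blocks Theta (alpha (k + 1)) in
   rows and columns k, k + 1, for all k of parity b. *)
Definition block_fun (b : bool) (u : int -> C) (k : int) : C :=
  if oddz k == b then
    Theta (alpha (k + 1)) 0 0 * u k + Theta (alpha (k + 1)) 0 1 * u (k + 1)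
  else
    Theta (alpha k) 1 0 * u (k - 1) + Theta (alpha k) 1 1 * u k.

Fact block_subproof b (u : ell2 R) : block_fun b u \in @square_summable R.
Proof.
pose absf (v : int -> C) (k : int) : C := (Normc.normc (v k))%:C%C.
have normc_real (x : R) : 0 <= x -> Normc.normc (x%:C)%C = x.
  by move=> x0; rewrite /= expr0n addr0 sqrtr_sqr ger0_norm.
have absP v : v \in @square_summable R -> absf v \in @square_summable R.
  by apply: square_summable_le => k; rewrite normc_real ?normc_ge0.
pose w := absf (fun k => u (k + -1)) + (absf u + absf (fun k => u (k + 1))).
apply: (@square_summable_le _ w) => [k|]; last first.
  by rewrite !square_summableD ?absP ?square_summable_shift// ell2_prop.
rewrite /w !fctE /absf -!rmorphD normc_real ?addr_ge0 ?normc_ge0//.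
have T1 a i j x : Normc.normc (Theta (alpha a) i j * x) <= Normc.normc x.
  by rewrite Normc.normcM ler_piMl ?normc_ge0 ?Theta_le1 ?verblunsky_lt1.
rewrite /block_fun; case: ifP => _; apply: le_trans (le_normcD _ _) _.
- by rewrite ler_wpDl ?normc_ge0// lerD.
- by rewrite addrA ler_wpDr ?normc_ge0// lerD.
Qed.

Definition block_op b (u : ell2 R) : ell2 R := Ell2 (block_subproof b u).

Fact block_op_linear b : linear (block_op b).
Proof.
move=> a u v; apply/val_inj/funext => k.
rewrite /= /block_fun !fctE /block_fun /=.
by case: ifP => _; rewrite /= /GRing.scale/=; ring.
Qed.

HB.instance Definition _ b :=
  GRing.isLinear.Build C (ell2 R) (ell2 R) _ (block_op b) (block_op_linear b).

Definition cmvV : {linear ell2 R -> ell2 R} := block_op true.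
Definition cmvW : {linear ell2 R -> ell2 R} := block_op false.

Local Ltac decide_eqs := repeat
  match goal with |- context [@eq_op ?T ?x ?y] =>
    (have -> : @eq_op T x y = true by lia) ||
    (have -> : @eq_op T x y = false by lia)
  end.

Lemma cmvV_block k (i j : 'I_2) :
  entry cmvV (2 * k - 1 + i%:Z) (2 * k - 1 + j%:Z) = Theta (alpha (2 * k)) i j.
Proof.
rewrite entryE /= /block_fun oddz_odd.
case: i => -[|[|//]] i; case: j => -[|[|//]] j /=; decide_eqs.
all: by rewrite ?mulr0 ?mulr1 ?addr0 ?add0r; congr (Theta (alpha _) _ _);
  by [exact: val_inj | lia].
Qed.

Lemma cmvV_off_block k l (i j : 'I_2) : k != l ->
  entry cmvV (2 * k - 1 + i%:Z) (2 * l - 1 + j%:Z) = 0.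
Proof.
rewrite entryE /= /block_fun oddz_odd.
case: i => -[|[|//]] i; case: j => -[|[|//]] j /= kl; decide_eqs.
all: by rewrite !mulr0 addr0.
Qed.

Lemma cmvW_block k (i j : 'I_2) :
  entry cmvW (2 * k + i%:Z) (2 * k + j%:Z) = Theta (alpha (2 * k + 1)) i j.
Proof.
rewrite entryE /= /block_fun oddz_even.
case: i => -[|[|//]] i; case: j => -[|[|//]] j /=; decide_eqs.
all: by rewrite ?mulr0 ?mulr1 ?addr0 ?add0r; congr (Theta (alpha _) _ _);
  by [exact: val_inj | lia].
Qed.

Lemma cmvW_off_block k l (i j : 'I_2) : k != l ->
  entry cmvW (2 * k + i%:Z) (2 * l + j%:Z) = 0.
Proof.
rewrite entryE /= /block_fun oddz_even.
case: i => -[|[|//]] i; case: j => -[|[|//]] j /= kl; decide_eqs.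
all: by rewrite !mulr0 addr0.
Qed.

Definition cmv : {linear ell2 R -> ell2 R} := cmvV \o cmvW.

Definition green_g (z : C) (k : int) : C := entry (resolvent cmv z) k k.

Definition green_h (z : C) (k : int) : C :=
  if oddz k then entry (resolvent cmv z) (k - 1) k
  else entry (resolvent cmv z) k (k - 1).

End CMV.

(* Main.v *)
Require Import Defs.
From mathcomp Require Import all_boot all_order all_algebra.
From mathcomp Require Import complex.
From mathcomp Require Import all_classical all_reals all_analysis.
From mathcomp Require Import zify ring lra.
Import Order.TTheory GRing.Theory Num.Theory.
Import numFieldNormedType.Exports.
Local Open Scope classical_set_scope.
Local Open Scope ring_scope.

(* The column u = (U - z)^-1 delta_l solves u = W^* v, v = V^* (z u + delta_l).
   At each site, the blocks Theta_k^* act as scattering matrices: the part of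
   the lattice to the right of k (to the left of k - 1) reflects with a
   coefficient x (w) which is, up to O(z^n), the outcome of finitely many steps
   of the Schur algorithm with parameters - conj alpha_(k + 1 + i) (parameters
   alpha_(k - 1 - i)).  Closing the block Theta_k with b = alpha_k by x and w
   gives, with p = b + z w, D = 1 + z (conj b w - x p) and
   rho = sqrt (1 - |b|^2),
     g(z, k) D = x p,   g(z, k - 1) D = w (z x - conj b),   h(z, k) D = rho x.
   (i) Hence h p = rho g; as h(0, k) is nonzero, g and h determine b / rho,
   thus b, then w modulo o(z^(N - 1)), then x modulo o(z^N).
   (ii) As b is nonzero, the first two equations determine x and w modulo
   o(z^m) as soon as z x and z w are known modulo o(z^m); induct on m <= N.
   The Schur algorithm then recovers the Verblunsky coefficients from x, w. *)

Set Implicit Arguments.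
Unset Strict Implicit.
Unset Printing Implicit Defensive.

(** * The resolvent near the origin *)

Local Notation rho a := (sqrtC (1 - `|a| ^+ 2)).

Section Resolvent.
Variable R : realType.
Local Notation C := R[i].

Lemma sqr_rho (a : C) : rho a ^+ 2 = 1 - a * a^*.
Proof. by rewrite sqrtCK normCK. Qed.

Lemma rho_neq0 (a : C) : `|a| < 1 -> rho a != 0.
Proof. by move=> a1; rewrite sqrtC_eq0 subr_eq0 eq_sym lt_eqF// expr_lt1. Qed.

Lemma rho_conj (a : C) : rho a^* = rho a.
Proof. by rewrite norm_conjC. Qed.

Fact conj_subproof (alpha : verblunsky R) k : `|(alpha k)^*| < 1.
Proof. by rewrite norm_conjC verblunsky_lt1. Qed.

Definition conjv (alpha : verblunsky R) : verblunsky R :=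
  Verblunsky (conj_subproof alpha).

Lemma oddzD1 (k : int) : oddz (k + 1) = ~~ oddz k.
Proof. by rewrite /oddz; lia. Qed.

Lemma oddzB1 (k : int) : oddz (k - 1) = ~~ oddz k.
Proof. by rewrite /oddz; lia. Qed.

(** Each [Theta a] is symmetric and unitary, so its inverse is [Theta] of the conjugate parameter.
    Relating [beta] to [alpha] by an equation allows cancellation in either order. *)
Lemma block_funK (alpha beta : verblunsky R) b (f : int -> C) :
    (forall k, beta k = (alpha k)^*) ->
  block_fun beta b (block_fun alpha b f) = f.
Proof.
move=> ba; apply/funext => k; rewrite /block_fun oddzD1 oddzB1 addrK subrK.
have [kb|kb] := eqVneq (oddz k) b; rewrite ?kb.
  have -> : (~~ b == b) = false by case: (b).
  rewrite !mxE/= !ba rho_conj.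
  set a := alpha _; have := sqr_rho a; set r := rho a => r2.
  transitivity ((a * a^* + r ^+ 2) * f k); first by ring.
  by rewrite r2; ring.
have -> : (~~ oddz k == b) by move: kb; case: (b); case: oddz.
rewrite !mxE/= !ba rho_conj conjCK.
set a := alpha _; have := sqr_rho a; set r := rho a => r2.
transitivity ((a * a^* + r ^+ 2) * f k); first by ring.
by rewrite r2; ring.
Qed.

(** The adjoint of V followed by that of W, acting on all sequences: limits are taken site by site
    before they are known to be square summable. *)
Definition cmv_inv (alpha : verblunsky R) (u : int -> C) : int -> C :=
  block_fun (conjv alpha) false (block_fun (conjv alpha) true u).

Lemma cmv_invE (alpha : verblunsky R) (u : ell2 R) (f : int -> C) :
  cmv alpha u = f :> (int -> C) <-> u = cmv_inv alpha f :> (int -> C).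
Proof.
rewrite /cmv_inv; split => [<-|uf].
  by rewrite /= !block_funK// => k; rewrite /= conjCK.
by rewrite /= uf !block_funK// => k; rewrite /= conjCK.
Qed.

Lemma block_funZD (alpha : verblunsky R) b (c : C) (f g : int -> C) k :
  block_fun alpha b (fun j => c * f j + g j) k =
    c * block_fun alpha b f k + block_fun alpha b g k.
Proof. by rewrite /block_fun; case: ifP => _; ring. Qed.

(** The entries of [Theta] have modulus at most 1, so each value of the image is controlled by [f]
    at the same site and at one neighbour. *)
Lemma block_bound (alpha : verblunsky R) b (w : int -> R) (c M : R)
    (f : int -> C) :
  (forall j, w (j + 1) <= c * w j) -> (forall j, w (j - 1) <= c * w j) ->
  0 <= M -> (forall j, Normc.normc (f j) <= M * w j) ->
  forall j, Normc.normc (block_fun alpha b f j) <= (1 + c) * M * w j.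
Proof.
move=> wD wB M0 fM j.
have T1 a i l x : Normc.normc (Theta (alpha a) i l * x) <= Normc.normc x.
  by rewrite Normc.normcM ler_piMl ?normc_ge0 ?Theta_le1 ?verblunsky_lt1.
rewrite /block_fun; case: ifP => _; apply: le_trans (le_normcD _ _) _.
- have := T1 (j + 1) 0 0 (f j); have := T1 (j + 1) 0 1 (f (j + 1)).
  have := fM j; have := fM (j + 1); have := ler_wpM2l M0 (wD j).
  by move: (Normc.normc _) (Normc.normc _) => *; lra.
- have := T1 j 1 0 (f (j - 1)); have := T1 j 1 1 (f j).
  have := fM j; have := fM (j - 1); have := ler_wpM2l M0 (wB j).
  by move: (Normc.normc _) (Normc.normc _) => *; lra.
Qed.

(* For w = 1 this bounds U^-1 in the sup norm; for w exponentially decaying it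
   shows that the Neumann series below stays square summable. *)
Lemma cmv_inv_bound (alpha : verblunsky R) (w : int -> R) (c M : R)
    (f : int -> C) :
  (forall j, w (j + 1) <= c * w j) -> (forall j, w (j - 1) <= c * w j) ->
  0 <= c -> 0 <= M -> (forall j, Normc.normc (f j) <= M * w j) ->
  forall j, Normc.normc (cmv_inv alpha f j) <= (1 + c) ^+ 2 * M * w j.
Proof.
move=> wD wB c0 M0 fM j.
have -> : (1 + c) ^+ 2 * M * w j = (1 + c) * ((1 + c) * M) * w j by ring.
apply: block_bound => //; first by apply: mulr_ge0; lra.
by move=> i; exact: block_bound.
Qed.

(** The limit is the supremum of the lower ends of the intervals of radius [c * 2^-1 ^+ m] around
    [x m]. The hypothesis for equal indices makes these radii nonnegative. *)
Lemma cauchy_geom (x : nat -> R) (c : R) :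
    (forall m p, (m <= p)%N -> `|x p - x m| <= c * 2^-1 ^+ m) ->
  exists l, forall m, `|l - x m| <= c * 2^-1 ^+ m.
Proof.
move=> xc; pose A := [set x m - c * 2^-1 ^+ m | m in setT].
have ubA p : ubound A (x p + c * 2^-1 ^+ p).
  move=> _ [m _ <-]; have [mp|/ltnW pm] := leqP m p.
    have := xc _ _ mp; have := xc _ _ (leqnn p); rewrite subrr normr0.
    by rewrite ler_norml => ? /andP[]; lra.
  have := xc _ _ pm; have := xc _ _ (leqnn m); rewrite subrr normr0.
  by rewrite ler_norml => ? /andP[]; lra.
have A0 : A !=set0 by exists (x 0%N - c * 2^-1 ^+ 0), 0%N.
exists (sup A) => m.
have /= := ub_le_sup (ex_intro _ _ (ubA 0%N)) (ex_intro2 _ _ m I erefl).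
by have := ge_sup A0 (ubA m); rewrite ler_norml => *; apply/andP; split; lra.
Qed.

Lemma normc_ReIm (x y : R) : Normc.normc (x +i* y)%C <= `|x| + `|y|.
Proof.
rewrite -[leRHS]ger0_norm ?addr_ge0// -sqrtr_sqr ler_wsqrtr//.
rewrite -[x ^+ 2]real_normK ?num_real// -[y ^+ 2]real_normK ?num_real//.
by rewrite sqrrD; have := mulr_ge0 (normr_ge0 x) (normr_ge0 y); lra.
Qed.

Lemma normc_Re (z : C) : `|complex.Re z : R| <= Normc.normc z.
Proof.
by case: z => x y /=; rewrite -sqrtr_sqr ler_wsqrtr// lerDl sqr_ge0.
Qed.

Lemma normc_Im (z : C) : `|complex.Im z : R| <= Normc.normc z.
Proof.
by case: z => x y /=; rewrite -sqrtr_sqr ler_wsqrtr// lerDr sqr_ge0.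
Qed.

Lemma cauchy_geomC (x : nat -> C) (c : R) :
    (forall m p, (m <= p)%N -> Normc.normc (x p - x m) <= c * 2^-1 ^+ m) ->
  exists l, forall m, Normc.normc (l - x m) <= 2 * c * 2^-1 ^+ m.
Proof.
move=> xc.
have [m p mp|a aP] := @cauchy_geom (fun n => complex.Re (x n)) c.
  by apply: le_trans (xc _ _ mp); apply: le_trans (normc_Re _); rewrite raddfB.
have [m p mp|b bP] := @cauchy_geom (fun n => complex.Im (x n)) c.
  by apply: le_trans (xc _ _ mp); apply: le_trans (normc_Im _); rewrite raddfB.
exists (a +i* b)%C => m; have := aP m; have := bP m.
case: (x m) => u v /= bv au; apply: le_trans (normc_ReIm _ _) _.
by rewrite -mulrA mulr2n mulrDl mul1r lerD.
Qed.

(** Neighbouring weights differ by a factor of at most 2, so [cmv_inv_bound] applies with [c = 2]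
    and yields the constant 9. For [z] of modulus at most 1/18 the Neumann iteration then contracts
    by 1/2. *)
Definition expdecay (k j : int) : R := 2^-1 ^+ `|j - k|%N.

Lemma expdecay_ge0 k j : 0 <= expdecay k j.
Proof. by rewrite exprn_ge0. Qed.

Lemma expdecay_le2 k i j : (`|i - j| <= 1)%N ->
  expdecay k i <= 2 * expdecay k j.
Proof.
move=> ij; rewrite /expdecay.
have : (`|j - k| <= `|i - k|.+1)%N by lia.
have h1 : (2^-1 : R) <= 1 by lra.
have h0 : (0 : R) <= 2^-1 by [].
move=> /(ler_wiXn2l h0 h1); rewrite exprS; lra.
Qed.

(** Here [e] will enumerate a half-line; as [e n] has absolute value at least [n], the geometric
    series of ratio 1/2 dominates. *)
Lemma esum_geom (e : nat -> int) : injective e -> (forall n, (n <= `|e n|)%N) ->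
  (\esum_(j in range e) ((expdecay 0 j) ^+ 2)%:E <= 2%:E)%E.
Proof.
move=> einj en; rewrite esum_image; last by move=> x y _ _ /einj.
rewrite -nneseries_esumT => [|n]; last by rewrite lee_fin sqr_ge0.
apply: lime_le.
  by apply: is_cvg_nneseries => n *; rewrite lee_fin sqr_ge0.
apply: nearW => n; rewrite sumEFin lee_fin.
have h1 : (2^-1 : R) <= 1 by lra.
have h0 : (0 : R) <= 2^-1 by [].
have h2 : `|2^-1 : R| < 1 by rewrite ger0_norm; lra.
have h3 : (0 : R) < 2^-1 by rewrite invr_gt0.
apply: (@le_trans _ _ (series (geometric 1 2^-1) n)); last first.
  apply: le_trans (geometric_le_lim n ler01 h3 h2) _.
  by have -> : 1 * (1 - 2^-1)^-1 = 2 :> R by field.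
rewrite /series/=; apply: ler_sum => i _; rewrite mul1r /expdecay subr0 -exprM.
by apply: ler_wiXn2l => //; have := en i; lia.
Qed.

Lemma expdecay_ell2 k (c : R) (u : int -> C) :
  (forall j, Normc.normc (u j) <= c * expdecay k j) -> u \in @square_summable R.
Proof.
move=> uc; pose w j : C := (expdecay 0 j)%:C%C.
have sw : w \in @square_summable R.
  apply/asboolP; rewrite /summable (esumID (range Posz))// !setTI.
  have wE j : `|(Normc.normc (w j) ^+ 2)%:E|%E = ((expdecay 0 j) ^+ 2)%:E.
    rewrite /w /= expr0n addr0 sqrtr_sqr ger0_norm ?sqr_ge0//.
    by rewrite ger0_norm ?expdecay_ge0.
  rewrite (eq_esum (fun j _ => wE j)).
  rewrite [X in (_ + X)%E](eq_esum (fun j _ => wE j)).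
  have -> : ~` range Posz = range Negz.
    apply/seteqP; split => [[n|n] h|_ [n _ <-] [m _]]//.
    by case: h; exists n.
  rewrite (@le_lt_trans _ _ (2%:E + 2%:E)%E)// ?ltry//.
  by apply: leeD; apply: esum_geom => [x y []//|n]; lia.
apply: (@square_summable_le _ (c%:C%C *: (fun j => w (j + - k)))) => [j|].
  apply: le_trans (uc j) _.
  rewrite Normc.normcM /w /expdecay subr0 /= !expr0n !addr0 !sqrtr_sqr.
  by rewrite [`|_ ^+ _|]ger0_norm ?exprn_ge0// ler_wpM2r ?exprn_ge0// ler_norm.
by apply: rpredZ; apply: square_summable_shift.
Qed.

(** The partial sums of the series of z^i U^(-i-1) delta_k, obtained by iterating u = U^-1 (z u +
    delta_k) from 0. *)
Definition neumann (alpha : verblunsky R) (z : C) (k : int) (m : nat) :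
    int -> C :=
  iter m (fun f => cmv_inv alpha (fun j => z * f j + (j == k)%:R)) (fun=> 0).

Lemma cmv_invZD (alpha : verblunsky R) (c : C) (f g : int -> C) :
  cmv_inv alpha (fun j => c * f j + g j) =
    (fun k => c * cmv_inv alpha f k + cmv_inv alpha g k).
Proof.
apply/funext => k; rewrite /cmv_inv -block_funZD.
congr (block_fun _ _ _ _).
by apply/funext => j; rewrite block_funZD.
Qed.

(** With [f] arbitrary, this serves both for two consecutive iterates and for the limit against an
    iterate. *)
Lemma neumann_sub (alpha : verblunsky R) z k m (f : int -> C) j :
  cmv_inv alpha (fun j => z * f j + (j == k)%:R) j - neumann alpha z k m.+1 j =
    z * cmv_inv alpha (fun i => f i - neumann alpha z k m i) j.
Proof.
apply/eqP; rewrite subr_eq; apply/eqP.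
rewrite -[neumann _ _ _ m.+1]/(cmv_inv alpha
  (fun j => z * neumann alpha z k m j + (j == k)%:R)).
rewrite -[RHS](f_equal (fun h => h j) (cmv_invZD _ _ _ _)).
by congr cmv_inv; apply/funext => i; ring.
Qed.

Lemma neumann_step (alpha : verblunsky R) z k m j :
    Normc.normc z <= 18^-1 ->
  Normc.normc (neumann alpha z k m.+1 j - neumann alpha z k m j)
    <= 9 * expdecay k j * 2^-1 ^+ m.
Proof.
move=> z18; elim: m j => [|m IH] j.
  rewrite subr0 expr0 mulr1 -[9]mulr1.
  have -> : 9 * 1 = (1 + 2) ^+ 2 * 1 :> R by ring.
  apply: cmv_inv_bound => //.
  - by move=> i; apply: expdecay_le2; lia.
  - by move=> i; apply: expdecay_le2; lia.
  move=> i; rewrite mulr0 add0r mul1r; have [->|ik] := eqVneq i k.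
    by rewrite /expdecay subrr Normc.normc1.
  by rewrite Normc.normc0 expdecay_ge0.
pose d i := neumann alpha z k m.+1 i - neumann alpha z k m i.
have -> : neumann alpha z k m.+2 j - neumann alpha z k m.+1 j =
    z * cmv_inv alpha d j by rewrite -neumann_sub.
rewrite Normc.normcM.
have M0 : 0 <= 9 * 2^-1 ^+ m :> R by rewrite mulr_ge0// exprn_ge0.
have := @cmv_inv_bound alpha (expdecay k) 2 _ d _ _ _ M0 _ j.
have q i : expdecay k (i + 1) <= 2 * expdecay k i.
  by apply: expdecay_le2; lia.
have q' i : expdecay k (i - 1) <= 2 * expdecay k i.
  by apply: expdecay_le2; lia.
move=> /(_ q q' _ _)/(ler_pM (normc_ge0 _) (normc_ge0 _) z18).
move=> h; apply: le_trans (h _ _) _ => //.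
  by move=> i; rewrite mulrAC IH.
by rewrite [2^-1 ^+ m.+1]exprS; lra.
Qed.

Lemma geom_small (c e : R) : 0 < e -> exists m : nat, c * 2^-1 ^+ m <= e.
Proof.
move=> e0; exists (Num.bound `|c / e|); set m := Num.bound _.
have cm : c <= e * m%:R.
  rewrite -ler_pdivrMl// mulrC; apply: le_trans (ler_norm _) _.
  exact/ltW/archi_boundP/normr_ge0.
have m2 : m%:R <= 2 ^+ m :> R by rewrite -natrX ler_nat ltnW// ltn_expl.
rewrite exprVn ler_pdivrMr ?exprn_gt0//; apply: le_trans cm _.
by rewrite ler_wpM2l// ltW.
Qed.

(** The sitewise limit of the Neumann iterates inherits their exponential decay, hence lies in
    [ell2]; it is a fixed point because it and its image are close to the same iterate. *)
Lemma cmv_sol_exists (alpha : verblunsky R) (z : C) (k : int) :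
  Normc.normc z <= 18^-1 -> exists u : ell2 R, cmv alpha u - z *: u = delta R k.
Proof.
move=> z18.
have tail j m p : (m <= p)%N ->
  Normc.normc (neumann alpha z k p j - neumann alpha z k m j)
    <= 18 * expdecay k j * 2^-1 ^+ m.
  move=> mp.
  (* Telescoping: 9 * 2^-q summed over m <= q < p equals 18 * (2^-m - 2^-p). *)
  apply: (@le_trans _ _ (18 * expdecay k j * (2^-1 ^+ m - 2^-1 ^+ p))).
    rewrite -(subnK mp); elim: (p - m)%N => [|q IH].
      by rewrite !subrr mulr0 Normc.normc0.
    have := neumann_step alpha k (q + m) j z18.
    move/(lerD IH)/(le_trans (le_normcD _ _)).
    rewrite addSn addrC subrKA => h; apply: le_trans h _.
    by rewrite [2^-1 ^+ (q + m).+1]exprS; lra.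
  rewrite ler_wpM2l ?mulr_ge0 ?expdecay_ge0// gerBl.
  by rewrite exprn_ge0.
have /choice[L LP] : forall j, exists l, forall m,
    Normc.normc (l - neumann alpha z k m j) <= 36 * expdecay k j * 2^-1 ^+ m.
  move=> j; have [l lP] := cauchy_geomC (tail j); exists l => m.
  by apply: le_trans (lP m) _; lra.
have Ldecay j : Normc.normc (L j) <= 36 * expdecay k j.
  by have := LP j 0%N; rewrite subr0 expr0 mulr1.
pose u := Ell2 (expdecay_ell2 Ldecay); exists u.
suff uE : L = cmv_inv alpha (fun j => z * L j + (j == k)%:R).
  have /cmv_invE Lu : u = cmv_inv alpha (fun j => z * L j + (j == k)%:R)
    :> (int -> C) by [].
  apply/val_inj/funext => j.
  by rewrite /= !fctE [X in X - _](congr1 (@^~ j) Lu) addrAC subrr add0r.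
apply/funext => j; apply/eqP; rewrite -subr_eq0; apply/eqP/Normc.eq0_normc.
apply/eqP; rewrite eq_le normc_ge0 andbT; apply/ler_addgt0Pr => e e0.
rewrite add0r; have [m me] := geom_small (36 * expdecay k j) e0.
apply: le_trans me.
have M0 : 0 <= 36 * 2^-1 ^+ m :> R by rewrite mulr_ge0// exprn_ge0.
have q i : expdecay k (i + 1) <= 2 * expdecay k i.
  by apply: expdecay_le2; lia.
have q' i : expdecay k (i - 1) <= 2 * expdecay k i.
  by apply: expdecay_le2; lia.
pose d i := L i - neumann alpha z k m i.
have := @cmv_inv_bound alpha (expdecay k) 2 _ d q q' _ M0 _ j.
move/(_ _ _)/(ler_pM (normc_ge0 _) (normc_ge0 _) z18).
rewrite -Normc.normcM -neumann_sub => h.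
have -> : L j - cmv_inv alpha (fun i => z * L i + (i == k)%:R) j =
   (L j - neumann alpha z k m.+1 j) -
   (cmv_inv alpha (fun i => z * L i + (i == k)%:R) j
     - neumann alpha z k m.+1 j).
  by ring.
apply: le_trans (le_normcD _ _) _; rewrite normcN.
have {}h := h _ _.
(* Both terms are at most 18 * 2^-m times the weight: the first by 36 / 2, the second by 9 * 36 /
   18. *)
apply: le_trans (lerD (LP j m.+1) (h _ _)) _ => //.
  by move=> i; rewrite mulrAC LP.
by rewrite exprS; lra.
Qed.

(** This covers every solution in [ell2], in particular the one selected by [resolvent], and is
    uniform in [z]. The fixed point equation is used repeatedly to improve a crude sup norm
    bound. *)
Lemma cmv_sol_bound (alpha : verblunsky R) (z : C) (k : int) (u : ell2 R) :
    Normc.normc z <= 18^-1 -> cmv alpha u - z *: u = delta R k ->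
  forall j, Normc.normc (u j) <= 9.
Proof.
move=> z18 /eqP; rewrite subr_eq => /eqP uE.
have {}uE : u = cmv_inv alpha (fun j => z * u j + (j == k)%:R) :> (int -> C).
  by apply/cmv_invE; rewrite uE; apply/funext => j; rewrite /= !fctE addrC.
(* Each squared modulus is at most the whole sum, and t <= t^2 + 1. *)
have [M uM] : exists M : R, forall j, Normc.normc (u j) <= M.
  have /asboolP su := ell2_prop u.
  have := su; rewrite summableE => sf.
  pose S := (\esum_(j in [set: int]) `|(Normc.normc (u j) ^+ 2)%:E|)%E.
  exists (fine S + 1) => j.
  have : (`|(Normc.normc (u j) ^+ 2)%:E| <= S)%E.
    apply: esum_ge; exists [set j]; first by split.
    by rewrite fsbig_set1.
  rewrite -[X in (_ <= X)%E](fineK sf) lee_fin ger0_norm ?sqr_ge0//.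
  rewrite -/S; have := sqr_ge0 (Normc.normc (u j)).
  have := sqr_ge0 (Normc.normc (u j) - 1); rewrite sqrrB; lra.
have M0 : 0 <= M by apply: le_trans (uM 0); exact: normc_ge0.
(* With constant weight, U^-1 has sup norm bound 4, and 4 * ((8 + X) / 18 + 1) <= 8 + X / 2. *)
have un n j : Normc.normc (u j) <= 8 + M * 2^-1 ^+ n.
  elim: n j => [|n IH] j; first by rewrite expr0 mulr1; have := uM j; lra.
  rewrite [in leLHS]uE.
  have X0 : 0 <= M * 2^-1 ^+ n by rewrite mulr_ge0// exprn_ge0.
  set X := M * _ in IH X0.
  have := @cmv_inv_bound alpha (fun=> 1) 1 ((8 + X) / 18 + 1)
    (fun j => z * u j + (j == k)%:R).
  rewrite !mulr1 => /(_ _ _ _ _ _ j) h; apply: le_trans (h _ _ _ _ _) _ => //.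
  - by clear h; lra.
  - move=> i; clear h; apply: le_trans (le_normcD _ _) _; rewrite Normc.normcM.
    have := ler_pM (normc_ge0 _) (normc_ge0 _) z18 (IH i).
    have : Normc.normc ((i == k)%:R : C) <= 1.
      by case: eqP => _; rewrite ?Normc.normc1 ?Normc.normc0.
    by clear IH; lra.
  clear h IH; rewrite [2^-1 ^+ n.+1]exprS mulrCA -/X; lra.
move=> j; have [n Mn] := geom_small M ltr01.
by have := un n j; lra.
Qed.

End Resolvent.

(** * Orders of vanishing at the origin *)

Section Orders.
Variable R : realType.
Local Notation C := R[i].
Implicit Types a b : C -> C.

(* a = O(z^n) at 0; the full neighbourhood also controls the value a 0. *)
Definition Opow n a :=
  exists2 K : C, 0 <= K & \forall z \near (0 : C), `|a z| <= K * `|z| ^+ n.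

(* a = o(z^n) at 0, where the value a 0 is irrelevant. *)
Definition opow n a :=
  forall e : C, 0 < e -> \forall z \near (0 : C)^', `|a z| <= e * `|z| ^+ n.

Lemma near_dnbhs (P : C -> Prop) :
  (\forall z \near (0 : C), P z) -> \forall z \near (0 : C)^', P z.
Proof. exact: nbhs_dnbhs. Qed.

Lemma near_all (P : C -> Prop) :
  (forall z, P z) -> \forall z \near (0 : C), P z.
Proof. by move=> h; apply: filterS filterT => z _. Qed.

Lemma Opow_near n b a :
  (\forall z \near (0 : C), a z = b z) -> Opow n b -> Opow n a.
Proof.
move=> ab [K K0 bK]; exists K => //.
by apply: filterS2 ab bK => z ->.
Qed.

Lemma opow_near n b a :
  (\forall z \near (0 : C), a z = b z) -> opow n b -> opow n a.
Proof.
move=> /near_dnbhs ab bn e e0.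
by apply: filterS2 ab (bn e e0) => z ->.
Qed.

Lemma OpowD n a b : Opow n a -> Opow n b -> Opow n (fun z => a z + b z).
Proof.
move=> [K K0 aK] [L L0 bL]; exists (K + L); first exact: addr_ge0.
apply: filterS2 aK bL => z az bz.
by rewrite (le_trans (ler_normD _ _))// mulrDl lerD.
Qed.

Lemma opowD n a b : opow n a -> opow n b -> opow n (fun z => a z + b z).
Proof.
move=> an bn e e0; have e2 : 0 < e / 2 by rewrite divr_gt0.
apply: filterS2 (an _ e2) (bn _ e2) => z az bz.
by rewrite (le_trans (ler_normD _ _))// [e]splitr mulrDl lerD.
Qed.

Lemma OpowN n a : Opow n a -> Opow n (fun z => - a z).
Proof.
by move=> [K K0 aK]; exists K => //; apply: filterS aK => z; rewrite normrN.
Qed.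

Lemma opowN n a : opow n a -> opow n (fun z => - a z).
Proof. by move=> an e /an; apply: filterS => z; rewrite normrN. Qed.

Lemma OpowB n a b : Opow n a -> Opow n b -> Opow n (fun z => a z - b z).
Proof. by move=> an bn; apply: OpowD => //; exact: OpowN. Qed.

Lemma OpowM m n a b : Opow m a -> Opow n b -> Opow (m + n) (fun z => a z * b z).
Proof.
move=> [K K0 aK] [L L0 bL]; exists (K * L); first exact: mulr_ge0.
apply: filterS2 aK bL => z az bz.
by rewrite normrM exprD mulrACA ler_pM.
Qed.

Lemma OpowMl n a b : Opow 0 a -> Opow n b -> Opow n (fun z => a z * b z).
Proof. exact: OpowM. Qed.

Lemma opowMl n a b : Opow 0 a -> opow n b -> opow n (fun z => a z * b z).
Proof.
move=> [K K0 aK] bn e e0; have K1 : 0 < K + 1 by rewrite ltr_wpDl.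
apply: filterS2 (near_dnbhs aK) (bn _ (divr_gt0 e0 K1)) => z az bz.
rewrite normrM expr0 mulr1 in az *.
apply: le_trans (ler_pM _ _ az bz) _ => //.
rewrite mulrA ler_wpM2r ?exprn_ge0//.
by rewrite mulrCA ger_pMr// ler_pdivrMr// mul1r lerDl.
Qed.

Lemma Opow_cst (c : C) : Opow 0 (fun=> c).
Proof.
exists `|c| => //.
by apply: filterS filterT => z _; rewrite expr0 mulr1.
Qed.

Lemma Opow_id n a : Opow n a -> Opow n.+1 (fun z => z * a z).
Proof.
move=> [K K0 aK]; exists K => //; apply: filterS aK => z az.
by rewrite normrM exprS mulrCA ler_wpM2l.
Qed.

Lemma OpowW m n a : (m <= n)%N -> Opow n a -> Opow m a.
Proof.
move=> mn [K K0 aK]; exists K => //.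
have z1 : \forall z \near (0 : C), `|z| <= 1 by apply: nbhs0_le.
apply: filterS2 aK z1 => z az zle1; apply: le_trans az _.
by rewrite ler_wpM2l// ler_wiXn2l.
Qed.

Lemma OpowX n a : Opow n a -> Opow n (fun z => z * a z).
Proof. by move=> /Opow_id; apply: OpowW. Qed.

(** The bound is required only off the origin, where the factor [z] cancels. *)
Lemma opow_idV n a : opow n.+1 (fun z => z * a z) -> opow n a.
Proof.
move=> an e /an; rewrite /dnbhs !near_withinE; apply: filterS => z za z0.
by have := za z0; rewrite normrM exprS mulrCA ler_pM2l// normr_gt0.
Qed.

Lemma opow_id n a : opow n a -> opow n.+1 (fun z => z * a z).
Proof.
move=> an e /an; apply: filterS => z za.
by rewrite normrM exprS mulrCA ler_wpM2l.
Qed.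

Lemma Opow_opow n a : Opow n.+1 a -> opow n a.
Proof.
move=> [K K0 aK] e e0; have K1 : 0 < K + 1 by rewrite ltr_wpDl.
have ze : \forall z \near (0 : C), `|z| <= e / (K + 1).
  by apply: nbhs0_le; rewrite divr_gt0.
apply: filterS2 (near_dnbhs aK) (near_dnbhs ze) => z az zle.
apply: le_trans az _; rewrite exprS mulrA ler_wpM2r ?exprn_ge0//.
apply: le_trans (ler_wpM2l K0 zle) _.
by rewrite mulrCA ger_pMr// ler_pdivrMr// mul1r lerDl.
Qed.

Lemma opowW m n a : (m <= n)%N -> opow n a -> opow m a.
Proof.
move=> mn an e e0; have := near_dnbhs (nbhs0_le (V := C) ltr01).
apply: filterS2 (an e e0) => z az z1; apply: le_trans az _.
by rewrite ler_wpM2l ?ler_wiXn2l// ltW.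
Qed.

Lemma opow0_cst (c : C) : opow 0 (fun=> c) -> c = 0.
Proof.
have [->//|c0] := eqVneq c 0; have cn : 0 < `|c| by rewrite normr_gt0.
have c2 : 0 < `|c| / 2 by rewrite divr_gt0.
move=> /(_ _ c2)/filter_ex[z]; rewrite expr0 mulr1 => h.
by rewrite lt_geF// ltr_pdivrMr// ltr_pMr ?ltr1n in h.
Qed.

(** Close to 0, [a] differs from [c] by at most half of [|c|], so its modulus stays at least the
    other half. *)
Lemma invr_Opow (c : C) a : c != 0 -> Opow 1 (fun z => a z - c) ->
  (\forall z \near (0 : C), a z != 0) /\ Opow 0 (fun z => (a z)^-1).
Proof.
move=> c0 [K K0 aK]; have K1 : 0 < K + 1 by rewrite ltr_wpDl.
have cn : 0 < `|c| by rewrite normr_gt0.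
have ze : \forall z \near (0 : C), `|z| <= `|c| / 2 / (K + 1).
  by apply: nbhs0_le; rewrite !divr_gt0.
have lb : \forall z \near (0 : C), `|c| / 2 <= `|a z|.
  apply: filterS2 aK ze => z az zle; rewrite expr1 in az.
  have h : `|a z - c| <= `|c| / 2.
    rewrite (le_trans az)// (le_trans (ler_wpM2l K0 zle))// mulrA ler_pdivrMr//.
    by rewrite mulrC ler_wpM2l ?lerDl// divr_ge0.
  have := lerB_normD c (a z - c); rewrite [c + _]addrC subrK; apply: le_trans.
  by rewrite lerBrDr [leRHS]splitr lerD2l.
have c2 : 0 < `|c| / 2 by rewrite divr_gt0.
split; first by apply: filterS lb => z /(lt_le_trans c2); rewrite normr_gt0.
exists (`|c| / 2)^-1; first by rewrite invr_ge0 ltW.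
apply: filterS lb => z lz; rewrite expr0 mulr1 normfV lef_pV2//.
by rewrite posrE; exact: lt_le_trans lz.
Qed.

Lemma invrD_Opow (c : C) a : c != 0 -> Opow 0 a ->
  (\forall z \near (0 : C), c + z * a z != 0) /\
  Opow 0 (fun z => (c + z * a z)^-1).
Proof.
move=> c0 /Opow_id za; apply: (invr_Opow c0); apply: Opow_near za.
by apply: near_all => z; rewrite addrC addKr.
Qed.

(** The neighbourhood in [Opow] contains 0, where the bound vanishes. *)
Lemma Opow1_at0 (c : C) a : Opow 1 (fun z => a z - c) -> a 0 = c.
Proof.
move=> [K _ /nbhs_singleton]; rewrite normr0 expr1 mulr0 normr_le0 subr_eq0.
by move/eqP.
Qed.

End Orders.

(** * The truncated Schur algorithm *)

(** Boundedness near 0 by structural descent. [OpowX] is tried before [OpowMl], which would leave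
    the bare factor [z] as a goal. *)
Local Ltac bdd := repeat first [assumption | apply: Opow_cst | apply: OpowX
  | apply: OpowD | apply: OpowN | apply: OpowMl].

Section Schur.
Variable R : realType.
Local Notation C := R[i].

(** The Schur function with parameters [gam 0], ..., [gam (n - 1)] followed by zeros. The
    denominator has the shape [1 + z * _] expected by [invrD_Opow]. *)
Fixpoint schur n (gam : nat -> C) (z : C) : C :=
  if n is n'.+1 then
    let s := schur n' (gam \o succn) z in
    (gam 0%N + z * s) / (1 + z * ((gam 0%N)^* * s))
  else 0.

Lemma schur_Opow n gam : Opow 0 (schur n gam).
Proof.
elim: n gam => [|n IH] gam; first exact: Opow_cst.
have s := IH (gam \o succn).
have [_ d] := invrD_Opow (oner_neq0 C) (OpowMl (Opow_cst (gam 0%N)^*) s).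
by apply: OpowMl => //; bdd.
Qed.

Lemma schur_den n (g : C) gam :
  \forall z \near (0 : C), 1 + z * (g * schur n gam z) != 0.
Proof.
have [] // := invrD_Opow (oner_neq0 C) (OpowMl (Opow_cst g) (schur_Opow n gam)).
Qed.

(** Transfer of the error across one block: the mismatch between the outgoing wave and the reflected
    incoming one is a bounded factor times a mismatch one site further. The two sides differ by a
    multiple of rho^2 - (1 - |g|^2) = 0. *)
Lemma schur_step (g s z a b : C) : 1 + z * (g^* * s) != 0 ->
  g * a + rho g * b - (g + z * s) / (1 + z * (g^* * s)) * a =
  (1 + z * (g^* * s))^-1 * rho g * (b - z * s * (rho g * a - g^* * b)).
Proof.
have := sqr_rho g; move: (rho g) (g^*) => r c r2 d0.
apply/eqP; rewrite -subr_eq0.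
have -> : g * a + r * b - (g + z * s) / (1 + z * (c * s)) * a -
  (1 + z * (c * s))^-1 * r * (b - z * s * (r * a - c * b)) =
  (r ^+ 2 - (1 - g * c)) * (z * s * a) / (1 + z * (c * s)) by field.
by rewrite r2 subrr !mul0r.
Qed.

(* Blocks of V and W alternate and only the former carry a factor z, so each
   two steps of the Schur algorithm gain one order in z. *)
Lemma schur_chain n p (gam : nat -> C) (u v U : nat -> C -> C) :
    (forall i, Opow 0 (u i)) -> (forall i, Opow 0 (v i)) ->
    (forall i, \forall z \near (0 : C), U i.+1 z = z * u i.+1 z) ->
    (forall i, \forall z \near (0 : C), if p (+) odd i then
        v i z = gam i * U i z + rho (gam i) * U i.+1 z /\
        v i.+1 z = rho (gam i) * U i z - (gam i)^* * U i.+1 z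
      else
        u i z = gam i * v i z + rho (gam i) * v i.+1 z /\
        u i.+1 z = rho (gam i) * v i z - (gam i)^* * v i.+1 z) ->
  if p then Opow (uphalf n) (fun z => v 0%N z - schur n gam z * U 0%N z)
  else Opow n./2 (fun z => u 0%N z - schur n gam z * v 0%N z).
Proof.
elim: n p gam u v U => [|n IH] p gam u v U ub vb Uu step.
  case: ifP => _ /=.
    by apply: Opow_near (vb 0%N); apply: near_all => z; rewrite mul0r subr0.
  by apply: Opow_near (ub 0%N); apply: near_all => z; rewrite mul0r subr0.
have sb := schur_Opow n (gam \o succn).
have [dn0 db] := invrD_Opow (oner_neq0 C) (OpowMl (Opow_cst (gam 0%N)^*) sb).
have {}IH : if ~~ p
    then Opow (uphalf n) (fun z => v 1%N z - schur n (gam \o succn) z * U 1%N z)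
    else Opow n./2 (fun z => u 1%N z - schur n (gam \o succn) z * v 1%N z).
  apply: (IH _ _ (u \o succn) (v \o succn) (U \o succn)) => //= i.
  by move: (step i.+1) => /=; rewrite addbN -addNb.
have := step 0%N; rewrite addbF => step0.
case: p {step} IH step0 => /= IH step0.
  (* Here the next incoming wave is [U 1 = z * u 1], so a factor [z] comes out and the order rises
     from [n./2] to [uphalf n.+1]. *)
  have IH' := OpowMl (OpowMl db (Opow_cst (rho (gam 0%N)))) (Opow_id IH).
  apply: Opow_near IH'; near=> z.
  have [-> v1] : v 0%N z = gam 0%N * U 0%N z + rho (gam 0%N) * U 1%N z /\
    v 1%N z = rho (gam 0%N) * U 0%N z - (gam 0%N)^* * U 1%N z by near: z.
  have Uz : U 1%N z = z * u 1%N z by near: z; exact: Uu.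
  have d0 : 1 + z * ((gam 0%N)^* * schur n (gam \o succn) z) != 0 by near: z.
  by rewrite schur_step// v1 Uz; ring.
(* No factor [z] is gained here: [n.+1./2] is [uphalf n]. *)
have IH' := OpowMl (OpowMl db (Opow_cst (rho (gam 0%N)))) IH.
apply: Opow_near IH'; near=> z.
have [-> u1] : u 0%N z = gam 0%N * v 0%N z + rho (gam 0%N) * v 1%N z /\
  u 1%N z = rho (gam 0%N) * v 0%N z - (gam 0%N)^* * v 1%N z by near: z.
have Uz : U 1%N z = z * u 1%N z by near: z; exact: Uu.
have d0 : 1 + z * ((gam 0%N)^* * schur n (gam \o succn) z) != 0 by near: z.
by rewrite schur_step// Uz u1; ring.
Unshelve. all: by end_near. Qed.

Lemma schur_first n gam : Opow 1 (fun z => schur n.+1 gam z - gam 0%N).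
Proof.
have sb := schur_Opow n (gam \o succn).
have [dn0 db] := invrD_Opow (oner_neq0 C) (OpowMl (Opow_cst (gam 0%N)^*) sb).
have c := Opow_cst (1 - gam 0%N * (gam 0%N)^*).
have h := Opow_id (OpowMl (OpowMl c sb) db).
apply: Opow_near h; near=> z => /=.
have d0 : 1 + z * ((gam 0%N)^* * schur n (gam \o succn) z) != 0 by near: z.
by field.
Unshelve. all: by end_near. Qed.

Lemma schur_inj0 n (gam1 gam2 : nat -> C) :
    opow 0 (fun z => schur n.+1 gam1 z - schur n.+1 gam2 z) ->
  gam1 0%N = gam2 0%N.
Proof.
move=> o12; have [K1 K2] := (schur_first n gam1, schur_first n gam2).
have : opow 0 (fun=> gam1 0%N - gam2 0%N).
  have h := opowD (opowD o12 (Opow_opow K2)) (opowN (Opow_opow K1)).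
  by apply: opow_near h; apply: near_all => z; ring.
by move/opow0_cst/eqP; rewrite subr_eq0 => /eqP.
Qed.

(** The constant terms give [gam1 0 = gam2 0 = g]. The difference is then z (1 - |g|^2) (s1 - s2)
    over the product of the two denominators, where [s1] and [s2] have the shifted parameters;
    cancelling [z] lowers the order by one and the induction continues. *)
Lemma schur_inj N n (gam1 gam2 : nat -> C) : (N < n)%N ->
    (forall i, `|gam1 i| < 1) ->
    opow N (fun z => schur n gam1 z - schur n gam2 z) ->
  forall i, (i <= N)%N -> gam1 i = gam2 i.
Proof.
elim: N n gam1 gam2 => [|N IH] [//|n] gam1 gam2 Nn g1 o12.
all: have g0 : gam1 0%N = gam2 0%N by exact: schur_inj0 (opowW _ o12).
  by case.
have sb1 := schur_Opow n (gam1 \o succn).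
have sb2 := schur_Opow n (gam2 \o succn).
have d1 := schur_den n (gam1 0%N)^* (gam1 \o succn).
have d2 := schur_den n (gam2 0%N)^* (gam2 \o succn).
have g1c : 1 - gam1 0%N * (gam1 0%N)^* != 0.
  by rewrite -sqr_rho expf_neq0// rho_neq0.
case=> [//|i] iN; apply: (IH n (gam1 \o succn) (gam2 \o succn)) => //.
  by move=> j; exact: g1.
apply: opow_idV.
have c : Opow 0 (fun z => (1 - gam1 0%N * (gam1 0%N)^*)^-1 *
    ((1 + z * ((gam1 0%N)^* * schur n (gam1 \o succn) z)) *
     (1 + z * ((gam2 0%N)^* * schur n (gam2 \o succn) z)))) by bdd.
apply: opow_near (opowMl c o12); near=> z => /=.
have d1z : 1 + z * ((gam1 0%N)^* * schur n (gam1 \o succn) z) != 0 by near: z.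
have d2z : 1 + z * ((gam2 0%N)^* * schur n (gam2 \o succn) z) != 0 by near: z.
rewrite -g0 in d2z *; move: g1c d1z d2z; move: (_^*) => ? ? ? ?.
by field; do ?[apply/andP; split].
Unshelve. all: by end_near. Qed.

End Schur.

(** * Green's function as a scattering problem *)

Section Green.
Variable R : realType.
Local Notation C := R[i].
Variable alpha : verblunsky R.

Definition green z j k : C := entry (resolvent (cmv alpha) z) j k.

(* With u the column above, these are W u and z u + delta_k = V (W u). *)
Definition greenW z j k : C :=
  cmvW alpha (resolvent (cmv alpha) z (delta R k)) j.

Definition greenU z j k : C := z * green z j k + (j == k)%:R.

Lemma near_normc (r : R) : 0 < r -> \forall z \near (0 : C), Normc.normc z <= r.
Proof.
move=> r0; have : \forall z \near (0 : C), `|z| <= r%:C%C.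
  by apply: nbhs0_le; rewrite ltcR.
by apply: filterS => z; rewrite -[`|z|]/((Normc.normc z)%:C%C) lecR.
Qed.

(** A partial inverse returns a true preimage of any point in the range, and [cmv_sol_exists] puts
    [delta R k] there. *)
Lemma resolvent_sol z k : Normc.normc z <= 18^-1 ->
  cmv alpha (resolvent (cmv alpha) z (delta R k))
    - z *: resolvent (cmv alpha) z (delta R k) = delta R k.
Proof.
move=> z18; have [u uE] := cmv_sol_exists alpha k z18.
apply: (@pinvK _ _ (fun=> 0) setT (fun w => cmv alpha w - z *: w)).
by rewrite inE; exists u.
Qed.

Lemma greenE z j k : green z j k = resolvent (cmv alpha) z (delta R k) j.
Proof. exact: entryE. Qed.

Lemma normc_Opow (a : C -> C) (M : R) :
  (\forall z \near (0 : C), Normc.normc (a z) <= M) -> Opow 0 a.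
Proof.
move=> aM; have M0 : 0 <= M.
  by have /= := nbhs_singleton aM; apply: le_trans; exact: normc_ge0.
exists M%:C%C; first by rewrite lecR.
apply: filterS aM => z; rewrite expr0 mulr1.
by rewrite -[`|a z|]/((Normc.normc (a z))%:C%C) lecR.
Qed.

Lemma inv18_gt0 : 0 < 18^-1 :> R.
Proof. by rewrite invr_gt0. Qed.

Lemma green_Opow j k : Opow 0 (fun z => green z j k).
Proof.
apply: (@normc_Opow _ 9); apply: filterS (near_normc inv18_gt0) => z z18.
by rewrite greenE; exact: (cmv_sol_bound z18 (resolvent_sol k z18)).
Qed.

Lemma greenW_Opow j k : Opow 0 (fun z => greenW z j k).
Proof.
apply: (@normc_Opow _ 18); apply: filterS (near_normc inv18_gt0) => z z18.
have /= := @block_bound _ alpha false (fun=> 1) 1 9 _ _ _ _ _ j.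
have -> : (1 + 1) * 9 * 1 = 18 :> R by ring.
apply=> // [_|_|i]; rewrite mulr1 //.
exact: (cmv_sol_bound z18 (resolvent_sol k z18)).
Qed.

(** The equations W u = V^* (z u + delta_k) and u = W^* (W u), read on the sites [j] and [j + 1]:
    these carry a block of V for odd [j] and of W for even [j]. *)
Lemma green_block z j k : Normc.normc z <= 18^-1 ->
  if oddz j then
    greenW z j k = - (alpha (j + 1))^* * greenU z j k
      + rho (alpha (j + 1)) * greenU z (j + 1) k /\
    greenW z (j + 1) k = rho (alpha (j + 1)) * greenU z j k
      + alpha (j + 1) * greenU z (j + 1) k
  else
    green z j k = - (alpha (j + 1))^* * greenW z j k
      + rho (alpha (j + 1)) * greenW z (j + 1) k /\
    green z (j + 1) k = rho (alpha (j + 1)) * greenW z j k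
      + alpha (j + 1) * greenW z (j + 1) k.
Proof.
move=> z18; have := resolvent_sol k z18; set u := resolvent _ _ _ => uE.
have {}uE : cmv alpha u = (fun i => greenU z i k) :> (int -> C).
  move/eqP: uE; rewrite subr_eq => /eqP ->; apply/funext => i.
  by rewrite /greenU greenE -/u /= !fctE addrC.
have wE : block_fun (conjv alpha) false (fun i => greenW z i k) = u.
  exact: block_funK.
have vE : block_fun (conjv alpha) true (fun i => greenU z i k)
    = fun i => greenW z i k.
  by rewrite -uE; exact: block_funK.
have gE i : green z i k = u i by rewrite greenE.
case: ifP => jo.
  have := congr1 (fun f => f j) vE; have := congr1 (fun f => f (j + 1)) vE.
  rewrite /= /block_fun oddzD1 jo /= !mxE /= rho_conj conjCK addrK => <- <-.
  by [].
have := congr1 (fun f => f j) wE; have := congr1 (fun f => f (j + 1)) wE.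
rewrite /= /block_fun oddzD1 jo /= !mxE /= rho_conj conjCK addrK !gE => <- <-.
by [].
Qed.

Definition schurR n (j : int) := schur n (fun i => - (alpha (j + 1 + i%:Z))^*).
Definition schurL n (j : int) := schur n (fun i => alpha (j - i%:Z)).

(** As [k <= j], no source lies strictly to the right of [j], so [schur_chain] applies; [n.*2] steps
    give order [n] for either parity of [j]. *)
Lemma schurR_green (n : nat) (j k : int) : k <= j ->
  Opow n (fun z => if oddz j
    then greenW z j k - schurR n.*2 j z * greenU z j k
    else green z j k - schurR n.*2 j z * greenW z j k).
Proof.
move=> kj.
have := @schur_chain R n.*2 (oddz j) (fun i => - (alpha (j + 1 + i%:Z))^*)
  (fun i z => green z (j + i%:Z) k) (fun i z => greenW z (j + i%:Z) k)
  (fun i z => greenU z (j + i%:Z) k).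
rewrite uphalf_double doubleK !addr0 => h.
suff : if oddz j
    then Opow n (fun z => greenW z j k - schurR n.*2 j z * greenU z j k)
    else Opow n (fun z => green z j k - schurR n.*2 j z * greenW z j k).
  by case: ifP.
apply: h => i; first exact: green_Opow.
- exact: greenW_Opow.
- apply: near_all => z; rewrite /greenU.
  by rewrite (_ : (j + i.+1%:Z == k) = false) ?addr0//; lia.
apply: filterS (near_normc inv18_gt0) => z z18.
have := green_block (j + i%:Z) k z18.
have -> : oddz (j + i%:Z) = oddz j (+) odd i by rewrite /oddz; lia.
have -> : j + i.+1%:Z = j + i%:Z + 1 by lia.
have -> : j + 1 + i%:Z = j + i%:Z + 1 by lia.
rewrite rmorphN/= conjCK normrN rho_conj.
by case: ifP => _ [-> ->]; split; ring.
Qed.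

(** The mirror image: the first block crossed starts at [j - 1], hence the opposite parity, and it
    is entered from its second site, hence parameters without conjugation or sign. *)
Lemma schurL_green (n : nat) (j k : int) : j <= k ->
  Opow n (fun z => if oddz j
    then green z j k - schurL n.*2 j z * greenW z j k
    else greenW z j k - schurL n.*2 j z * greenU z j k).
Proof.
move=> kj.
have := @schur_chain R n.*2 (~~ oddz j) (fun i => alpha (j - i%:Z))
  (fun i z => green z (j - i%:Z) k) (fun i z => greenW z (j - i%:Z) k)
  (fun i z => greenU z (j - i%:Z) k).
rewrite uphalf_double doubleK !subr0 => h.
suff : if ~~ oddz j
    then Opow n (fun z => greenW z j k - schurL n.*2 j z * greenU z j k)
    else Opow n (fun z => green z j k - schurL n.*2 j z * greenW z j k).
  by case: oddz.
apply: h => i; first exact: green_Opow.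
- exact: greenW_Opow.
- apply: near_all => z; rewrite /greenU.
  by rewrite (_ : (j - i.+1%:Z == k) = false) ?addr0//; lia.
apply: filterS (near_normc inv18_gt0) => z z18.
have := green_block (j - i.+1%:Z) k z18.
have -> : oddz (j - i.+1%:Z) = ~~ oddz j (+) odd i by rewrite /oddz; lia.
have -> : j - i.+1%:Z + 1 = j - i%:Z by lia.
by case: ifP => _ [-> ->]; split; ring.
Qed.

End Green.

(** * Closing one block by two reflection coefficients *)

Section Port.
Variable R : realType.
Local Notation C := R[i].

(** The determinant of 1 - Theta^* diag (z w, z x), simplified by rho^2 + |b|^2 = 1. *)
Definition portdet (b w x z : C) : C := 1 + z * (b^* * w - x * (b + z * w)).

(* A block Theta_k^* whose two ends are closed by the reflection coefficients
   z w and z x, with sources c0 and c1. *)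
Lemma two_port (b w x z in0 in1 out0 out1 c0 c1 : C) :
  out0 = - b^* * in0 + rho b * in1 /\ out1 = rho b * in0 + b * in1 ->
  in0 = z * (w * out0) + c0 -> in1 = z * (x * out1) + c1 ->
  out0 * portdet b w x z = c0 * (- b^* + z * x) + rho b * c1 /\
  out1 * portdet b w x z = rho b * c0 + c1 * (b + z * w).
Proof.
rewrite /portdet; have := sqr_rho b.
move: (rho b) (b^*) => r c r2 [outE0 outE1] inE0 inE1.
have -> : c0 = in0 - z * (w * out0) by rewrite inE0; ring.
have -> : c1 = in1 - z * (x * out1) by rewrite inE1; ring.
split; apply/eqP; rewrite -subr_eq0 outE0 outE1.
  set lhs := (X in X == 0).
  have -> : lhs = (r ^+ 2 - (1 - b * c)) * (z * x * in0) by rewrite /lhs; ring.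
  by rewrite r2 subrr mul0r.
set lhs := (X in X == 0).
have -> : lhs = (r ^+ 2 - (1 - b * c)) * (z * w * in1) by rewrite /lhs; ring.
by rewrite r2 subrr mul0r.
Qed.

Variable alpha : verblunsky R.

(** The source sits on the block, so both half-lines are reflectors with errors [e0] and [e1]. For
    odd [k] the block belongs to W and sends W u to u, and the source enters through a reflection.
    For even [k] it belongs to V, its output is W u, and a final reflection leads back to u. *)
Lemma green_port n (k l : int) : l = k \/ l = k - 1 ->
  let b := alpha k in
  let w := schurL alpha n.*2 (k - 1) in let x := schurR alpha n.*2 k in
  let s0 : C := (k - 1 == l)%:R in let s1 : C := (k == l)%:R in
  exists2 e0, Opow n e0 & exists2 e1, Opow n e1 &
  \forall z \near (0 : C),
  if oddz k then
    green alpha z (k - 1) l * portdet b (w z) (x z) z =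
      (w z * s0 + e0 z) * (- b^* + z * x z) + rho b * (x z * s1 + e1 z) /\
    green alpha z k l * portdet b (w z) (x z) z =
      rho b * (w z * s0 + e0 z) + (x z * s1 + e1 z) * (b + z * w z)
  else
    green alpha z (k - 1) l * portdet b (w z) (x z) z =
      w z * ((s0 + z * e0 z) * (- b^* + z * x z) + rho b * (s1 + z * e1 z))
      + e0 z * portdet b (w z) (x z) z /\
    green alpha z k l * portdet b (w z) (x z) z =
      x z * (rho b * (s0 + z * e0 z) + (s1 + z * e1 z) * (b + z * w z))
      + e1 z * portdet b (w z) (x z) z.
Proof.
move=> kl b w x s0 s1.
have e0n : Opow n _ := schurL_green alpha n (_ : k - 1 <= l).
have e1n : Opow n _ := schurR_green alpha n (_ : l <= k).
eexists; first by apply: e0n; case: kl => ->; lia.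
eexists; first by apply: e1n; case: kl => ->; lia.
apply: filterS (near_normc (inv18_gt0 R)) => z z18.
have := green_block alpha (k - 1) l z18.
rewrite oddzB1 subrK -/b -/w -/x; case: oddz => /= h.
  have := @two_port b (w z) (x z) z _ _ _ _ _ _ h; apply.
    by rewrite /greenU -/s0; ring.
  by rewrite /greenU -/s1; ring.
have := @two_port b (w z) (x z) z _ _ _ _
  (s0 + z * (green alpha z (k - 1) l - w z * greenW alpha z (k - 1) l))
  (s1 + z * (green alpha z k l - x z * greenW alpha z k l)) h.
case.
- by rewrite /greenU -/s0; ring.
- by rewrite /greenU -/s1; ring.
by move=> <- <-; split; ring.
Qed.

(** * The entries of Green's function next to the diagonal, up to O(z^n) *)

Section Formulas.
Variables (n : nat) (k : int).
Let b := alpha k.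
Let w := schurL alpha n.*2 (k - 1).
Let x := schurR alpha n.*2 k.
Let D z := portdet b (w z) (x z) z.

Lemma schurL_Opow m j : Opow 0 (schurL alpha m j).
Proof. exact: schur_Opow. Qed.

Lemma schurR_Opow m j : Opow 0 (schurR alpha m j).
Proof. exact: schur_Opow. Qed.

Lemma portdet_Opow : Opow 0 D.
Proof.
have wb := schurL_Opow n.*2 (k - 1); have xb := schurR_Opow n.*2 k.
by rewrite /D /portdet; bdd.
Qed.

Lemma predz_neq : (k - 1 == k) = false. Proof. by lia. Qed.
Lemma intz_neq_pred : (k == k - 1) = false. Proof. by lia. Qed.

Lemma green_diagR :
  Opow n (fun z => green alpha z k k * D z - x z * (b + z * w z)).
Proof.
have wb := schurL_Opow n.*2 (k - 1); have xb := schurR_Opow n.*2 k.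
have Db := portdet_Opow.
have /= [e0 e0n [e1 e1n +]] := green_port n (or_introl (erefl k)).
rewrite eqxx predz_neq /=; case: (oddz k) => E.
  have h : Opow n (fun z => rho b * e0 z + (b + z * w z) * e1 z).
    by apply: OpowD; apply: OpowMl => //; bdd.
  apply: Opow_near h; apply: filterS E => z [_].
  rewrite -/b -/(w z) -/(x z) -/(D z) => ->; ring.
have h : Opow n (fun z => (z * (x z * rho b)) * e0 z
    + (z * (x z * (b + z * w z)) + D z) * e1 z).
  by apply: OpowD; apply: OpowMl => //; bdd.
apply: Opow_near h; apply: filterS E => z [_].
by rewrite -/b -/(w z) -/(x z) -/(D z) => ->; ring.
Qed.

Lemma green_diagL :
  Opow n (fun z => green alpha z (k - 1) (k - 1) * D z
                   - w z * (- b^* + z * x z)).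
Proof.
have wb := schurL_Opow n.*2 (k - 1); have xb := schurR_Opow n.*2 k.
have Db := portdet_Opow.
have /= [e0 e0n [e1 e1n +]] := green_port n (or_intror (erefl (k - 1))).
rewrite eqxx intz_neq_pred /=; case: (oddz k) => E.
  have h : Opow n (fun z => (- b^* + z * x z) * e0 z + rho b * e1 z).
    by apply: OpowD; apply: OpowMl => //; bdd.
  apply: Opow_near h; apply: filterS E => z [+ _].
  rewrite -/b -/(w z) -/(x z) -/(D z) => ->; ring.
have h : Opow n (fun z => (z * (w z * (- b^* + z * x z)) + D z) * e0 z
    + (z * (w z * rho b)) * e1 z).
  by apply: OpowD; apply: OpowMl => //; bdd.
apply: Opow_near h; apply: filterS E => z [+ _].
by rewrite -/b -/(w z) -/(x z) -/(D z) => ->; ring.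
Qed.

(** Choosing the off-diagonal entry by the parity of [k] makes [x] appear in both cases; the
    transposed entry would have [w] instead. *)
Lemma green_off :
  Opow n (fun z => green_h alpha z k * D z - rho b * x z).
Proof.
have wb := schurL_Opow n.*2 (k - 1); have xb := schurR_Opow n.*2 k.
have Db := portdet_Opow.
rewrite /green_h; case: (boolP (oddz k)) => ko.
  have /= [e0 e0n [e1 e1n +]] := green_port n (or_introl (erefl k)).
  rewrite eqxx predz_neq ko /= => E.
  have h : Opow n (fun z => (- b^* + z * x z) * e0 z + rho b * e1 z).
    by apply: OpowD; apply: OpowMl => //; bdd.
  apply: Opow_near h; apply: filterS E => z [+ _].
  by rewrite -/(green alpha z _ _) -/b -/(w z) -/(x z) -/(D z) => ->; ring.
have /= [e0 e0n [e1 e1n +]] := green_port n (or_intror (erefl (k - 1))).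
rewrite eqxx intz_neq_pred (negbTE ko) /= => E.
have h : Opow n (fun z => (z * (x z * rho b)) * e0 z
    + (z * (x z * (b + z * w z)) + D z) * e1 z).
  by apply: OpowD; apply: OpowMl => //; bdd.
apply: Opow_near h; apply: filterS E => z [_].
by rewrite -/(green alpha z _ _) -/b -/(w z) -/(x z) -/(D z) => ->; ring.
Qed.

End Formulas.

End Port.

(** * Uniqueness *)

Section Main.
Variable R : realType.
Local Notation C := R[i].
Implicit Types alpha : verblunsky R.

Lemma portdet_inv alpha n k :
  let D z :=
    portdet (alpha k) (schurL alpha n (k - 1) z) (schurR alpha n k z) z in
  (\forall z \near (0 : C), D z != 0) /\ Opow 0 (fun z => (D z)^-1).
Proof.
have wb := schurL_Opow alpha n (k - 1); have xb := schurR_Opow alpha n k.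
by apply: invrD_Opow; [exact: oner_neq0 | bdd].
Qed.

Lemma green_h_Opow alpha k : Opow 0 (fun z => green_h alpha z k).
Proof. by rewrite /green_h; case: oddz; exact: green_Opow. Qed.

Lemma schurR_inj N n alpha1 alpha2 (k j : int) : (N < n)%N ->
    opow N (fun z => schurR alpha1 n k z - schurR alpha2 n k z) ->
  k + 1 <= j <= k + 1 + N%:Z -> alpha1 j = alpha2 j.
Proof.
move=> Nn o12 jk; have jE : j = k + 1 + `|(j - (k + 1))%R|%N%:Z by lia.
have jN : (`|(j - (k + 1))%R| <= N)%N by lia.
have := schur_inj Nn _ o12 jN; rewrite -jE => h.
apply: (can_inj conjCK); apply: oppr_inj; apply: h => i.
by rewrite normrN norm_conjC verblunsky_lt1.
Qed.

Lemma schurL_inj N n alpha1 alpha2 (k j : int) : (N < n)%N ->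
    opow N (fun z => schurL alpha1 n k z - schurL alpha2 n k z) ->
  k - N%:Z <= j <= k -> alpha1 j = alpha2 j.
Proof.
move=> Nn o12 jk; have jE : j = k - `|(k - j)%R|%N%:Z by lia.
have jN : (`|(k - j)%R| <= N)%N by lia.
have := schur_inj Nn _ o12 jN; rewrite -jE; apply => i.
exact: verblunsky_lt1.
Qed.

(** Squared moduli give |b1|^2 (1 - |b2|^2) = |b2|^2 (1 - |b1|^2), so the moduli agree; then the two
    [rho] agree and cancel. *)
Lemma rho_cross (b1 b2 : C) : `|b1| < 1 -> `|b2| < 1 ->
  rho b2 * b1 = rho b1 * b2 -> b1 = b2.
Proof.
move=> b1l b2l e; have r20 := rho_neq0 b2l; have r10 := rho_neq0 b1l.
have nrho b : `|b| < 1 -> `|rho b| ^+ 2 = 1 - `|b| ^+ 2.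
  move=> b_lt1; rewrite ger0_norm ?sqrtCK//.
  by rewrite sqrtC_ge0 subr_ge0 expr_le1// ltW.
have nn : `|b1| ^+ 2 = `|b2| ^+ 2.
  have := congr1 (fun z => `|z| ^+ 2) e; rewrite !normrM !exprMn !nrho// => h.
  apply/eqP; rewrite -subr_eq0; move/eqP: h; rewrite -subr_eq0.
  by congr (_ == _); ring.
by move: e; rewrite nn; apply: mulfI; rewrite -nn.
Qed.

(** Two Schur steps suffice to write h as its constant term, - rho times the conjugate of
    [alpha (k + 1)], plus O(z); this constant is h(0, k). *)
Lemma off_invertible alpha k : green_h alpha 0 k != 0 ->
  (\forall z \near (0 : C), green_h alpha z k != 0) /\
  Opow 0 (fun z => (green_h alpha z k)^-1).
Proof.
set n := 1%N.
have wb := schurL_Opow alpha n.*2 (k - 1); have xb := schurR_Opow alpha n.*2 k.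
have hb := green_h_Opow alpha k.
set gam := fun i : nat => - (alpha (k + 1 + i%:Z))^*.
have h1 : Opow 1 (fun z => green_h alpha z k - rho (alpha k) * gam 0%N).
  have a1 := green_off alpha 1 k.
  have a2 := OpowMl (Opow_cst (rho (alpha k))) (schur_first 1 gam).
  have c : Opow 0 (fun z => - green_h alpha z k *
      ((alpha k)^* * schurL alpha n.*2 (k - 1) z
       - schurR alpha n.*2 k z * (alpha k + z * schurL alpha n.*2 (k - 1) z))).
    by bdd.
  apply: Opow_near (OpowD (OpowD a1 a2) (Opow_id c)); apply: near_all => z.
  by rewrite /portdet -/(schurR alpha n.*2 k z); ring.
by rewrite (Opow1_at0 h1) => c0; exact: invr_Opow h1.
Qed.

(** Boundedness starts the induction, as z f is o(1); afterwards f = o(z^m) feeds the next step with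
    z f = o(z^(m + 1)). *)
Lemma opow_bootstrap (f g : C -> C) N : Opow 0 f -> Opow 0 g ->
    (forall m, (m <= N)%N ->
      opow m (fun z => z * f z) -> opow m (fun z => z * g z) ->
      opow m f /\ opow m g) ->
  opow N f /\ opow N g.
Proof.
move=> f0 g0 step; elim: N step => [|N IH] step.
  by apply: step => //; apply/Opow_opow/Opow_id.
have [fN gN] := IH (fun m mN => step m (leqW mN)).
by apply: step => //; exact: opow_id.
Qed.

(** * Comparison of two sequences at one site *)

Section Pair.
Variables alpha1 alpha2 : verblunsky R.
Variables (k : int) (N : nat).
(** One order beyond [N], so that errors O(z^n) are o(z^N). *)
Let n := N.+1.
Let b := alpha1 k.
Let w1 := schurL alpha1 n.*2 (k - 1).
Let w2 := schurL alpha2 n.*2 (k - 1).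
Let x1 := schurR alpha1 n.*2 k.
Let x2 := schurR alpha2 n.*2 k.
Let D1 z := portdet (alpha1 k) (w1 z) (x1 z) z.

(** With p = b + z w, the combination (h D - rho x) p - rho (g D - x p) equals D (h p - rho g), and
    D is invertible near 0. *)
Lemma off_ratio alpha :
  Opow n (fun z =>
    green_h alpha z k * (alpha k + z * schurL alpha n.*2 (k - 1) z)
    - rho (alpha k) * green alpha z k k).
Proof.
have wb := schurL_Opow alpha n.*2 (k - 1).
have [D0 Db] := portdet_inv alpha n.*2 k.
have G := OpowMl (Opow_cst (rho (alpha k))) (green_diagR alpha n k).
have pb : Opow 0 (fun z => alpha k + z * schurL alpha n.*2 (k - 1) z) by bdd.
have H := OpowMl pb (green_off alpha n k).
apply: Opow_near (OpowMl Db (OpowB H G)); near=> z.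
have d0 : portdet (alpha k) (schurL alpha n.*2 (k - 1) z)
    (schurR alpha n.*2 k z) z != 0 by near: z.
by field.
Unshelve. all: by end_near. Qed.

Lemma unique_off : (0 < N)%N -> green_h alpha1 0 k != 0 ->
    opow N (fun z => green_g alpha1 z k - green_g alpha2 z k) ->
    opow N (fun z => green_h alpha1 z k - green_h alpha2 z k) ->
  forall j : int, k - N%:Z <= j <= k + N%:Z + 1 -> alpha1 j = alpha2 j.
Proof.
move=> N0 h10 og oh.
have w1b : Opow 0 w1 := schurL_Opow _ _ _.
have w2b : Opow 0 w2 := schurL_Opow _ _ _.
have x1b : Opow 0 x1 := schurR_Opow _ _ _.
have x2b : Opow 0 x2 := schurR_Opow _ _ _.
have [h1n0 h1inv] := off_invertible h10.
have h2b := green_h_Opow alpha2 k.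
pose r1 := rho (alpha1 k); pose r2 := rho (alpha2 k).
(* Multiplied by h1, this is r2 (h1 p1 - r1 g1) - r1 (h2 p2 - r2 g2) + r1 r2 (g1 - g2) - r1 p2 (h1 -
   h2). *)
have p12 : opow N (fun z =>
    r2 * (alpha1 k + z * w1 z) - r1 * (alpha2 k + z * w2 z)).
  have q1 := opowMl (OpowMl h1inv (Opow_cst r2)) (Opow_opow (off_ratio alpha1)).
  have q2 := opowMl (OpowMl h1inv (Opow_cst r1)) (Opow_opow (off_ratio alpha2)).
  have q3 := opowMl (OpowMl h1inv (Opow_cst (r1 * r2))) og.
  have c4 : Opow 0
      (fun z => (green_h alpha1 z k)^-1 * (r1 * (alpha2 k + z * w2 z))).
    by bdd.
  have q4 := opowMl c4 oh.
  apply: opow_near (opowD (opowD q1 (opowN q2)) (opowD q3 (opowN q4))).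
  near=> z.
  have h0 : green_h alpha1 z k != 0 by near: z.
  rewrite /green -/(green_g alpha1 z k) -/(green_g alpha2 z k).
  by rewrite /r1 /r2 /w1 /w2; field.
have bE : alpha1 k = alpha2 k.
  apply: rho_cross; try exact: verblunsky_lt1.
  apply/eqP; rewrite -subr_eq0; apply/eqP; apply: opow0_cst.
  have c1 : Opow 0 (fun z => r2 * w1 z - r1 * w2 z) by bdd.
  have p0 := opowW (leq0n _) p12.
  apply: opow_near (opowD p0 (opowN (Opow_opow (Opow_id c1)))).
  by apply: near_all => z; rewrite /r1 /r2; ring.
have r0 : r1 != 0 by rewrite rho_neq0 ?verblunsky_lt1.
have zw : opow N (fun z => z * (w1 z - w2 z)).
  apply: opow_near (opowMl (Opow_cst r1^-1) p12); apply: near_all => z.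
  by rewrite /r2 -bE -/r1; field.
(* D depends on x too; collecting terms, the factor of x1 - x2 is r1 + z h2 (b + z w1), invertible
   near 0. *)
have x12 : opow N (fun z => x1 z - x2 z).
  have H1 := Opow_opow (green_off alpha1 n k).
  have H2 := Opow_opow (green_off alpha2 n k).
  have c1 : Opow 0 (fun z => green_h alpha2 z k * (alpha1 k + z * w1 z)) by bdd.
  have [den0 denb] := invrD_Opow r0 c1.
  have q1 := opowMl (portdet_Opow alpha1 n k) oh.
  have c2 : Opow 0 (fun z => green_h alpha2 z k * ((alpha1 k)^* - z * x2 z)).
    by bdd.
  have q2 := opowMl c2 zw.
  apply: opow_near (opowMl denb (opowD (opowD q1 q2) (opowD H2 (opowN H1)))).
  near=> z.
  have d0 : r1 + z * (green_h alpha2 z k * (alpha1 k + z * w1 z)) != 0.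
    by near: z.
  rewrite -bE -/r1 /portdet -/(w1 z) -/(w2 z) -/(x1 z) -/(x2 z).
  by field.
move=> j jk; have [jlt|jgt|->//] := ltgtP j k; last first.
  by apply: (schurR_inj _ x12); [rewrite /n; lia | lia].
(* Only z (w1 - w2) is controlled to order [N], so the left side reaches [k - 1 - (N - 1)] while the
   right side reaches [k + 1 + N]. *)
have ow : opow N.-1 (fun z => w1 z - w2 z) by apply: opow_idV; rewrite prednK.
by apply: (schurL_inj _ ow); [rewrite /n; lia | lia].
Unshelve. all: by end_near. Qed.

Lemma unique_diag : alpha1 k = alpha2 k -> b != 0 ->
    opow N (fun z => green_g alpha1 z (k - 1) - green_g alpha2 z (k - 1)) ->
    opow N (fun z => green_g alpha1 z k - green_g alpha2 z k) ->
  forall j : int, k - N%:Z - 1 <= j <= k + N%:Z + 1 -> alpha1 j = alpha2 j.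
Proof.
move=> bE b0 ogL ogR.
have w1b : Opow 0 w1 := schurL_Opow _ _ _.
have w2b : Opow 0 w2 := schurL_Opow _ _ _.
have x1b : Opow 0 x1 := schurR_Opow _ _ _.
have x2b : Opow 0 x2 := schurR_Opow _ _ _.
have gRb : Opow 0 (fun z => green_g alpha2 z k) := green_Opow alpha2 k k.
have gLb : Opow 0 (fun z => green_g alpha2 z (k - 1)) := green_Opow alpha2 _ _.
have bC0 : b^* != 0 by rewrite conjC_eq0.
have step m : (m <= N)%N ->
    opow m (fun z => z * (x1 z - x2 z)) ->
    opow m (fun z => z * (w1 z - w2 z)) ->
  opow m (fun z => x1 z - x2 z) /\ opow m (fun z => w1 z - w2 z).
  move=> mN ox ow; split.
    (* Subtracting the two relations g D = x p gives b (x1 - x2) as D1 (g1 - g2) plus bounded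
       multiples of z (w1 - w2) and z (x1 - x2), up to O(z^n). *)
    have c1 : Opow 0 (fun z => b^-1 * D1 z).
      by apply: OpowMl; [exact: Opow_cst | exact: portdet_Opow].
    have q1 := opowMl c1 (opowW mN ogR).
    have c2 : Opow 0 (fun z =>
      b^-1 * (green_g alpha2 z k * (b^* - z * x2 z) - x2 z)) by bdd.
    have c3 : Opow 0 (fun z =>
      - b^-1 * (green_g alpha2 z k * (b + z * w1 z) + w1 z)) by bdd.
    have GR alpha := opowW mN (Opow_opow (green_diagR alpha n k)).
    have G1 := opowMl (Opow_cst (- b^-1)) (GR alpha1).
    have G2 := opowMl (Opow_cst b^-1) (GR alpha2).
    apply: opow_near (opowD q1 (opowD (opowD (opowMl c2 ow) (opowMl c3 ox))
      (opowD G1 G2))).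
    apply: near_all => z; rewrite -bE -/b -/(w1 z) -/(w2 z) -/(x1 z) -/(x2 z).
    rewrite /D1 -/b /portdet /green.
    rewrite -/(green_g alpha1 z k) -/(green_g alpha2 z k).
    by field.
  (* The same for w, from g(z, k - 1) D = w (z x - conj b), now dividing by - conj b. *)
  have c1 : Opow 0 (fun z => - (b^*)^-1 * D1 z).
    by apply: OpowMl; [exact: Opow_cst | exact: portdet_Opow].
  have q1 := opowMl c1 (opowW mN ogL).
  have c2 : Opow 0 (fun z =>
    - (b^*)^-1 * (green_g alpha2 z (k - 1) * (b^* - z * x2 z) - x2 z)) by bdd.
  have c3 : Opow 0 (fun z =>
    (b^*)^-1 * (green_g alpha2 z (k - 1) * (b + z * w1 z) + w1 z)) by bdd.
  have GL alpha := opowW mN (Opow_opow (green_diagL alpha n k)).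
  have G1 := opowMl (Opow_cst (b^*)^-1) (GL alpha1).
  have G2 := opowMl (Opow_cst (- (b^*)^-1)) (GL alpha2).
  apply: opow_near (opowD q1 (opowD (opowD (opowMl c2 ow) (opowMl c3 ox))
    (opowD G1 G2))).
  apply: near_all => z; rewrite -bE -/b -/(w1 z) -/(w2 z) -/(x1 z) -/(x2 z).
  rewrite /D1 -/b /portdet /green.
  rewrite -/(green_g alpha1 z (k - 1)) -/(green_g alpha2 z (k - 1)).
  move: bC0; move: (b^*) => bC bC0; by field.
have [ox ow] : opow N (fun z => x1 z - x2 z) /\ opow N (fun z => w1 z - w2 z).
  by apply: opow_bootstrap step; bdd.
move=> j jk; have [jlt|jgt|->//] := ltgtP j k; last first.
  by apply: (schurR_inj _ ox); [rewrite /n; lia | lia].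
by apply: (schurL_inj _ ow); [rewrite /n; lia | lia].
Qed.

End Pair.
End Main.

Lemma littleo_opow (R : realType) (N : nat) (f g : R[i] -> R[i]) :
  (fun z : R[i] => `|f z| + `|g z|) =o_ (0^') (fun z : R[i] => z ^+ N) ->
  opow N f /\ opow N g.
Proof.
move/eqoP => o; split=> e e0; apply: filterS (o e e0) => z.
all: rewrite normrX (ger0_norm (addr_ge0 (normr_ge0 _) (normr_ge0 _))).
  by apply: le_trans; rewrite lerDl.
by apply: le_trans; rewrite lerDr.
Qed.

Theorem theorem1p4 (R : realType) (alpha1 alpha2 : verblunsky R) (k0 : int)
    (N : nat) (N_gt0 : (0 < N)%N) :
  (green_h alpha1 0 k0 != 0 \/ green_h alpha2 0 k0 != 0 ->
   (fun z : R[i] => `|green_g alpha1 z k0 - green_g alpha2 z k0|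
                    + `|green_h alpha1 z k0 - green_h alpha2 z k0|)
     =o_ (0^') (fun z : R[i] => z ^+ N) ->
   forall k : int, k0 - N%:Z <= k <= k0 + N%:Z + 1 -> alpha1 k = alpha2 k)
  /\
  (alpha1 k0 = alpha2 k0 -> alpha1 k0 != 0 ->
   (fun z : R[i] => `|green_g alpha1 z (k0 - 1) - green_g alpha2 z (k0 - 1)|
                    + `|green_g alpha1 z k0 - green_g alpha2 z k0|)
     =o_ (0^') (fun z : R[i] => z ^+ N) ->
   forall k : int, k0 - N%:Z - 1 <= k <= k0 + N%:Z + 1 -> alpha1 k = alpha2 k).
Proof.
split=> [h0 /littleo_opow[og oh]|bE b0 /littleo_opow[ogL ogR]]; last first.
  exact: unique_diag.
have [h10|h20] := h0; first exact: unique_off.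
(* The assumptions are symmetric in the two sequences, so their roles are exchanged. *)
move=> k kN; apply/esym; apply: (unique_off N_gt0 h20) kN.
  by apply: opow_near (opowN og); apply: near_all => z; rewrite opprB.
by apply: opow_near (opowN oh); apply: near_all => z; rewrite opprB.
Qed.
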